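(* Let $m\ge 2$, let $a_1,\dots,a_m\in\mathbb{C}^\times$, $k_1,\dots,k_m\in\mathbb{Z}_{\ge 1}$, and $\mathcal S\subseteq\{1,\dots,m\}$. Then the $\mathcal U(\mathfrak{sl}(m|1))$-module $E\bigl(\sum_{i=1}^m a_i x_i^{k_i},\mathcal S\bigr)$ is indecomposable if and only if $\gcd(k_1,\dots,k_m)=1$.
   Context: Everything is over $\mathbb{C}$. Index rows and columns of $(m+1)\times(m+1)$ matrices by $1,\dots,m,\bar 1$, with matrix units $e_{pq}$. The Lie superalgebra $\mathfrak{sl}(m|1)$ is spanned by the even elements $h_i:=e_{ii}+e_{\bar1\bar1}$ ($1\le i\le m$), $e_{ij}$ ($1\le i\ne j\le m$) and the odd elements $e_{i\bar1},e_{\bar1 i}$ ($1\le i\le m$), with bracket $[u,v]=uv-(-1)^{\bar u\bar v}vu$. Modules are $\mathbb{Z}_2$-graded. Exponential modules. For $g\in\mathbb{C}[x_1,\dots,x_m]$ and $\mathcal S\subseteq\{1,\dots,m\}$, $E(g,\mathcal S)$ is the vector space $\mathbb{C}[x_1,\dots,x_m,\xi]\,e^{g}=\mathbb{C}[x_1,\dots,x_m]e^g\oplus\mathbb{C}[x_1,\dots,x_m]\xi e^g$ ($\xi$ odd, $\xi^2=0$; the first summand is even, the second odd). For $f\in\mathbb{C}[x_1,\dots,x_m]$, $\varepsilon\in\{0,1\}$, define operators on it: $x_i$ acts by multiplication; $\partial_{x_i}(f\xi^\varepsilon e^g)=\bigl(\frac{\partial f}{\partial x_i}+f\frac{\partial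 g}{\partial x_i}\bigr)\xi^\varepsilon e^g$; $\xi\cdot(f\xi^\varepsilon e^g)=(1-\varepsilon)f\xi e^g$; $\partial_\xi(f\xi^\varepsilon e^g)=\varepsilon f e^g$. The $\mathfrak{sl}(m|1)$-action is: $h_i\mapsto x_i\partial_{x_i}+\xi\partial_\xi$ if $i\notin\mathcal S$ and $h_i\mapsto -x_i\partial_{x_i}-1+\xi\partial_\xi$ if $i\in\mathcal S$; for $i\neq j$, $e_{ij}\mapsto x_i\partial_{x_j}$ ($i,j\notin\mathcal S$), $\partial_{x_i}\partial_{x_j}$ ($i\in\mathcal S,j\notin\mathcal S$), $-x_ix_j$ ($i\notin\mathcal S,j\in\mathcal S$), $-x_j\partial_{x_i}$ ($i,j\in\mathcal S$); $e_{i\bar1}\mapsto x_i\partial_\xi$ ($i\notin\mathcal S$), $\partial_{x_i}\partial_\xi$ ($i\in\mathcal S$); $e_{\bar1 i}\mapsto \xi\partial_{x_i}$ ($i\notin\mathcal S$), $-x_i\xi$ ($i\in\mathcal S$). *)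

(* Defs.v *)
From HB Require Import structures.
From mathcomp Require Import all_boot all_order all_algebra.
From mathcomp Require Import reals complex mpoly ring.

Set Implicit Arguments.
Unset Strict Implicit.
Unset Printing Implicit Defensive.

Import GRing.Theory.
Local Open Scope ring_scope.

Section SpecialLinear.
Variables (C : fieldType) (m : nat).

(* The rows and columns 1, .., m are [ix i] with [i : 'I_m]; the extra index
   written 1 with a bar is [bar]. *)
Definition ix (i : 'I_m) : 'I_(m + 1) := lshift 1 i.
Definition bar : 'I_(m + 1) := rshift m ord0.
Definition par (p : 'I_(m + 1)) : bool := p == bar.

Definition h (i : 'I_m) : 'M[C]_(m + 1) :=
  delta_mx (ix i) (ix i) + delta_mx bar bar.

Definition sl : {vspace 'M[C]_(m + 1)} :=
  (\sum_(i < m) <[h i]>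
   + \sum_(i < m) \sum_(j < m | j != i) <[delta_mx (ix i) (ix j)]>
   + \sum_(i < m) <[delta_mx (ix i) bar]>
   + \sum_(i < m) <[delta_mx bar (ix i)]>)%VS.

(* [true] is the odd parity. *)
Definition mx_parity (b : bool) (u : 'M[C]_(m + 1)) : Prop :=
  forall p q, par p (+) par q != b -> u p q = 0.

(* The bracket of [u] of parity [b] with [v] of parity [c]. *)
Definition sbracket (b c : bool) (u v : 'M[C]_(m + 1)) : 'M[C]_(m + 1) :=
  u *m v - (-1) ^+ (b && c) *: (v *m u).

Definition vec_parity (V0 V1 : lmodType C) (b : bool) (v : V0 * V1) : Prop :=
  if b then v.1 = 0 else v.2 = 0.

(* A module over U(sl(m|1)), that is, a Z_2-graded representation of the Lie
   superalgebra sl(m|1). The values of [act] outside [sl] are irrelevant. *)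
Record slmod := SlMod {
  even_part : lmodType C;
  odd_part : lmodType C;
  act : 'M[C]_(m + 1) -> even_part * odd_part -> even_part * odd_part;
  act_linear_mx : forall c u u' v, u \in sl -> u' \in sl ->
    act (c *: u + u') v = c *: act u v + act u' v;
  act_linear : forall u, u \in sl -> forall c v v',
    act u (c *: v + v') = c *: act u v + act u v';
  act_parity : forall b c u v, u \in sl -> mx_parity b u -> vec_parity c v ->
    vec_parity (b (+) c) (act u v);
  act_bracket : forall b c u u' v, u \in sl -> u' \in sl ->
    mx_parity b u -> mx_parity c u' ->
    act (sbracket b c u u') v
      = act u (act u' v) - (-1) ^+ (b && c) *: act u' (act u v)
}.

Definition carrier (M : slmod) : lmodType C := (even_part M * odd_part M)%type.

Definition is_submodule (M : slmod) (W : carrier M -> Prop) : Prop :=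
  [/\ W 0,
      forall (c : C) (v w : carrier M), W v -> W w -> W (c *: v + w),
      forall v : carrier M, W v -> W (v.1, 0) /\ W (0, v.2)
    & forall u v, u \in sl -> W v -> W (act u v)].

Definition internal_direct_sum (M : slmod) (W1 W2 : carrier M -> Prop) : Prop :=
  (forall v, exists w1 w2, [/\ W1 w1, W2 w2 & v = w1 + w2])
  /\ (forall v, W1 v -> W2 v -> v = 0).

Definition indecomposable (M : slmod) : Prop :=
  (exists v : carrier M, v <> 0)
  /\ forall W1 W2 : carrier M -> Prop,
       is_submodule W1 -> is_submodule W2 -> internal_direct_sum W1 W2 ->
       (forall v, W1 v -> v = 0) \/ (forall v, W2 v -> v = 0).

End SpecialLinear.

Arguments sl {C m}.
Arguments bar {m}.

Section Exponential.
Variables (C : fieldType) (m : nat) (g : {mpoly C[m]}) (S : {set 'I_m}).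

(* The pair [(f0, f1)] stands for f0 e^g + f1 xi e^g. *)
Definition expV : lmodType C := ({mpoly C[m]} * {mpoly C[m]})%type.

Definition x_ (i : 'I_m) (v : expV) : expV := ('X_i * v.1, 'X_i * v.2).
Definition d_ (i : 'I_m) (v : expV) : expV :=
  (v.1^`M(i) + v.1 * g^`M(i), v.2^`M(i) + v.2 * g^`M(i)).
Definition xi (v : expV) : expV := (0, v.1).
Definition dxi (v : expV) : expV := (v.2, 0).

Definition act_h (i : 'I_m) (v : expV) : expV :=
  if i \in S then - x_ i (d_ i v) - v + xi (dxi v)
  else x_ i (d_ i v) + xi (dxi v).

Definition act_e (i j : 'I_m) (v : expV) : expV :=
  match i \in S, j \in S with
  | false, false => x_ i (d_ j v)
  | true, false => d_ i (d_ j v)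
  | false, true => - x_ i (x_ j v)
  | true, true => - x_ j (d_ i v)
  end.

Definition act_e_bar (i : 'I_m) (v : expV) : expV :=
  if i \in S then d_ i (dxi v) else x_ i (dxi v).

Definition act_bar_e (i : 'I_m) (v : expV) : expV :=
  if i \in S then - x_ i (xi v) else xi (d_ i v).

(* In [sl] the entry [u bar bar] is the sum of the other diagonal entries, so
   the coordinates of [u] on the basis of sl(m|1) are its other entries. *)
Definition exp_act (u : 'M[C]_(m + 1)) (v : expV) : expV :=
  \sum_(i < m) u (ix i) (ix i) *: act_h i v
  + \sum_(i < m) \sum_(j < m | j != i) u (ix i) (ix j) *: act_e i j v
  + \sum_(i < m) u (ix i) bar *: act_e_bar i v
  + \sum_(i < m) u bar (ix i) *: act_bar_e i v.

(* The action is the restriction to sl(m|1) of the oscillator action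
   u |-> \sum_(p, q) u p q X_p D_q of gl(m|1). *)
Definition oscX (p : 'I_(m + 1)) : expV -> expV :=
  match split p with
  | inl i => if i \in S then d_ i else x_ i
  | inr _ => xi
  end.
Definition oscD (p : 'I_(m + 1)) : expV -> expV :=
  match split p with
  | inl i => if i \in S then fun v => - x_ i v else d_ i
  | inr _ => dxi
  end.

Let parL i : par (@ix m i) = false.
Proof. by apply/negbTE; rewrite /par eq_lrshift. Qed.
Let parR : par (@bar m) = true. Proof. exact: eqxx. Qed.

Lemma oscX_ix i : oscX (ix i) = if i \in S then d_ i else x_ i.
Proof. by rewrite /oscX (unsplitK (inl i)). Qed.
Lemma oscX_bar : oscX bar = xi.
Proof. by rewrite /oscX (unsplitK (inr ord0)). Qed.
Lemma oscD_ix i : oscD (ix i) = if i \in S then fun v => - x_ i v else d_ i.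
Proof. by rewrite /oscD (unsplitK (inl i)). Qed.
Lemma oscD_bar : oscD bar = dxi.
Proof. by rewrite /oscD (unsplitK (inr ord0)). Qed.

Lemma pairP_ (v w : expV) : v.1 = w.1 -> v.2 = w.2 -> v = w.
Proof. by case: v w => [? ?] [? ?] /= -> ->. Qed.

Lemma x_linear i : linear (x_ i).
Proof. by move=> c v w; apply: pairP_; rewrite /= mulrDr scalerAr. Qed.
Lemma d_linear i : linear (d_ i).
Proof.
by move=> c v w; apply: pairP_;
  rewrite /= linearP /= mulrDl !scalerDr scalerAl addrACA.
Qed.
Lemma xi_linear : linear xi.
Proof. by move=> c v w; apply: pairP_; rewrite /= ?scaler0 ?addr0. Qed.
Lemma dxi_linear : linear dxi.
Proof. by move=> c v w; apply: pairP_; rewrite /= ?scaler0 ?addr0. Qed.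

Lemma oscX_linear p : linear (oscX p).
Proof.
rewrite /oscX; case: split => [i|_]; last exact: xi_linear.
by case: ifP => _; [apply: d_linear | apply: x_linear].
Qed.
Lemma oscD_linear p : linear (oscD p).
Proof.
rewrite /oscD; case: split => [i|_]; last exact: dxi_linear.
case: ifP => _; last exact: d_linear.
by move=> c v w; rewrite x_linear opprD scalerN.
Qed.
HB.instance Definition _ p :=
  GRing.isLinear.Build C expV expV _ (oscX p) (oscX_linear p).
HB.instance Definition _ p :=
  GRing.isLinear.Build C expV expV _ (oscD p) (oscD_linear p).

Lemma x_C i j v : x_ i (x_ j v) = x_ j (x_ i v).
Proof. by apply: pairP_; rewrite /= mulrCA. Qed.
Lemma d_C i j v : d_ i (d_ j v) = d_ j (d_ i v).
Proof.
have H (f : {mpoly C[m]}) :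
    (f^`M(j) + f * g^`M(j))^`M(i) + (f^`M(j) + f * g^`M(j)) * g^`M(i) =
    (f^`M(i) + f * g^`M(i))^`M(j) + (f^`M(i) + f * g^`M(i)) * g^`M(j).
  rewrite !mderivD !mderivM (mderiv_comm i j f) (mderiv_comm i j g); ring.
by apply: pairP_; apply: H.
Qed.
Lemma dx_C i j v : d_ i (x_ j v) = x_ j (d_ i v) + (i == j)%:R *: v.
Proof.
have H (f : {mpoly C[m]}) :
    ('X_j * f)^`M(i) + 'X_j * f * g^`M(i) =
    'X_j * (f^`M(i) + f * g^`M(i)) + (i == j)%:R *: f.
  rewrite mderivM mderivX mnm1E (eq_sym j); case: eqP => [->|_].
    have -> : (U_(j) - U_(j) = 0)%MM by apply/mnmP => k; rewrite mnmBE mnm0E subnn.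
    by rewrite mpolyX0 !scale1r mul1r; ring.
  by rewrite !scale0r mul0r; ring.
by apply: pairP_; apply: H.
Qed.

Variant index_spec : 'I_(m + 1) -> Type :=
| IndexIx i : index_spec (ix i)
| IndexBar : index_spec bar.
Lemma indexP p : index_spec p.
Proof.
rewrite -(splitK p); case: (split p) => [i|k] /=; first exact: IndexIx.
by rewrite (ord1 k); exact: IndexBar.
Qed.

Lemma mem_neq i j : i \in S -> (j \in S) = false -> (i == j) = false.
Proof. by move=> Hi Hj; apply/eqP => ij; rewrite -ij Hi in Hj. Qed.

Lemma x_N i v : x_ i (- v) = - x_ i v.
Proof. by apply: pairP_; rewrite /= mulrN. Qed.
Lemma d_N i v : d_ i (- v) = - d_ i v.
Proof. by apply: pairP_; rewrite /= mderivN mulNr opprD. Qed.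

Lemma xi_N v : xi (- v) = - xi v.
Proof. by apply: pairP_; rewrite /= ?oppr0. Qed.
Lemma dxi_N v : dxi (- v) = - dxi v.
Proof. by apply: pairP_; rewrite /= ?oppr0. Qed.
Lemma x_xi i v : x_ i (xi v) = xi (x_ i v).
Proof. by apply: pairP_; rewrite /= ?mulr0. Qed.
Lemma x_dxi i v : x_ i (dxi v) = dxi (x_ i v).
Proof. by apply: pairP_; rewrite /= ?mulr0. Qed.
Lemma d_xi i v : d_ i (xi v) = xi (d_ i v).
Proof. by apply: pairP_; rewrite /= ?mderiv0 ?mul0r ?addr0. Qed.
Lemma d_dxi i v : d_ i (dxi v) = dxi (d_ i v).
Proof. by apply: pairP_; rewrite /= ?mderiv0 ?mul0r ?addr0. Qed.
Lemma xi_xi v : xi (xi v) = 0.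
Proof. by apply: pairP_. Qed.
Lemma dxi_dxi v : dxi (dxi v) = 0.
Proof. by apply: pairP_. Qed.
Lemma dxi_xi v : dxi (xi v) = - xi (dxi v) + v.
Proof. by apply: pairP_; rewrite /= ?oppr0 ?add0r ?addNr. Qed.

Lemma vec_parity0 b : vec_parity b (0 : expV).
Proof. by case: b. Qed.
Lemma vec_parityD b (v w : expV) :
  vec_parity b v -> vec_parity b w -> vec_parity b (v + w).
Proof. by case: b => /= -> ->; rewrite addr0. Qed.
Lemma vec_parityZ b k (v : expV) : vec_parity b v -> vec_parity b (k *: v).
Proof. by case: b => /= ->; rewrite scaler0. Qed.

Lemma x_parity i b v : vec_parity b v -> vec_parity b (x_ i v).
Proof. by case: b => /= ->; rewrite mulr0. Qed.
Lemma d_parity i b v : vec_parity b v -> vec_parity b (d_ i v).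
Proof. by case: b => /= ->; rewrite mderiv0 mul0r addr0. Qed.
Lemma xi_parity b v : vec_parity b v -> vec_parity (~~ b) (xi v).
Proof. by case: b. Qed.
Lemma dxi_parity b v : vec_parity b v -> vec_parity (~~ b) (dxi v).
Proof. by case: b. Qed.

Let sg (b : bool) : C := (-1) ^+ b.

#[local] Opaque x_ d_ xi dxi.

Lemma oscXX p r v :
  oscX p (oscX r v) = sg (par p && par r) *: oscX r (oscX p v).
Proof.
rewrite /sg; case: (indexP p) => [i|]; case: (indexP r) => [j|];
  rewrite ?parL ?parR ?oscX_ix ?oscX_bar /= ?expr0 ?scale1r.
- case: ifP => Hi; case: ifP => Hj.
  + exact: d_C.
  + by rewrite dx_C (mem_neq Hi Hj) scale0r addr0.
  + by rewrite dx_C (mem_neq Hj Hi) scale0r addr0.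
  + exact: x_C.
- by case: ifP => _; rewrite ?d_xi ?x_xi.
- by case: ifP => _; rewrite ?d_xi ?x_xi.
- by rewrite xi_xi scaler0.
Qed.

Lemma oscDD p r v :
  oscD p (oscD r v) = sg (par p && par r) *: oscD r (oscD p v).
Proof.
rewrite /sg; case: (indexP p) => [i|]; case: (indexP r) => [j|];
  rewrite ?parL ?parR ?oscD_ix ?oscD_bar /= ?expr0 ?scale1r.
- case: ifP => Hi; case: ifP => Hj.
  + by rewrite !x_N !opprK x_C.
  + by rewrite d_N dx_C eq_sym (mem_neq Hi Hj) scale0r addr0.
  + by rewrite d_N dx_C eq_sym (mem_neq Hj Hi) scale0r addr0.
  + exact: d_C.
- by case: ifP => _; rewrite ?dxi_N ?d_dxi ?x_dxi.
- by case: ifP => _; rewrite ?dxi_N ?d_dxi ?x_dxi.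
- by rewrite dxi_dxi scaler0.
Qed.

Lemma oscDX q r v :
  oscD q (oscX r v) =
  sg (par q && par r) *: oscX r (oscD q v) + (q == r)%:R *: v.
Proof.
rewrite /sg; case: (indexP q) => [i|]; case: (indexP r) => [j|];
  rewrite ?parL ?parR ?oscX_ix ?oscX_bar ?oscD_ix ?oscD_bar /= ?expr0 ?scale1r.
- rewrite /ix eq_lshift.
  case: ifP => Hi; case: ifP => Hj.
  + by rewrite d_N dx_C eq_sym opprD addrNK.
  + by rewrite x_N x_C (mem_neq Hi Hj) scale0r addr0.
  + by rewrite d_C eq_sym (mem_neq Hj Hi) scale0r addr0.
  + exact: dx_C.
- rewrite /ix /bar eq_lrshift scale0r addr0.
  by case: ifP => _; rewrite ?xi_N ?d_xi ?x_xi.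
- rewrite /ix /bar eq_rlshift scale0r addr0.
  by case: ifP => _; rewrite ?d_dxi ?x_dxi.
- by rewrite eqxx scale1r expr1 scaleN1r dxi_xi.
Qed.

Definition osc (u : 'M[C]_(m + 1)) (v : expV) : expV :=
  \sum_p \sum_q u p q *: oscX p (oscD q v).

Lemma osc_mul u u' v :
  osc u (osc u' v) = osc (u *m u') v +
  \sum_p \sum_q \sum_r \sum_s (u p q * u' r s * sg (par q && par r)) *:
     oscX p (oscX r (oscD q (oscD s v))).
Proof.
have E : osc (u *m u') v = \sum_p \sum_q \sum_r \sum_s
    (u p q * u' r s * (q == r)%:R) *: oscX p (oscD s v).
  apply: eq_bigr => p _; rewrite [RHS]exchange_big /=.
  under [RHS]eq_bigr => r _ do rewrite exchange_big /=.
  rewrite [RHS]exchange_big; apply: eq_bigr => s _.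
  rewrite mxE scaler_suml; apply: eq_bigr => r _.
  rewrite (bigD1 r) //= eqxx mulr1 big1 ?addr0 // => q /negbTE ->.
  by rewrite mulr0 scale0r.
rewrite E -big_split; apply: eq_bigr => p _; rewrite -big_split.
apply: eq_bigr => q _; rewrite linear_sum linear_sum scaler_sumr -big_split.
apply: eq_bigr => r _; rewrite linear_sum linear_sum scaler_sumr -big_split.
apply: eq_bigr => s _ /=; rewrite !linearZ /= oscDX linearD !linearZ /=.
by rewrite !scalerDr !scalerA addrC.
Qed.

Lemma sum4_swap (I : finType) (V : nmodType) (F : I -> I -> I -> I -> V) :
  \sum_r \sum_s \sum_p \sum_q F r s p q = \sum_p \sum_q \sum_r \sum_s F r s p q.
Proof.
under eq_bigr => r _ do rewrite exchange_big /=.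
rewrite exchange_big /=; apply: eq_bigr => p _.
under eq_bigr => r _ do rewrite exchange_big /=.
by rewrite exchange_big.
Qed.

Lemma osc_bracket b c u u' v : mx_parity b u -> mx_parity c u' ->
  osc (sbracket b c u u') v
  = osc u (osc u' v) - (-1) ^+ (b && c) *: osc u' (osc u v).
Proof.
move=> Hu Hu'; rewrite !osc_mul.
have -> : osc (sbracket b c u u') v =
    osc (u *m u') v - (-1) ^+ (b && c) *: osc (u' *m u) v.
  rewrite scaler_sumr -sumrB; apply: eq_bigr => p _.
  rewrite scaler_sumr -sumrB; apply: eq_bigr => q _.
  by rewrite !mxE scalerA -scalerBl.
rewrite scalerDr opprD addrACA -[LHS]addr0; congr (_ + _); apply/esym/eqP.
rewrite subr_eq0; apply/eqP.
rewrite [in RHS]sum4_swap.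
rewrite scaler_sumr; apply: eq_bigr => p _.
rewrite scaler_sumr; apply: eq_bigr => q _.
rewrite scaler_sumr; apply: eq_bigr => r _.
rewrite scaler_sumr; apply: eq_bigr => s _.
have [Hb|/Hu ->] := eqVneq (par p (+) par q) b; last first.
  by rewrite mulr0 !mul0r !scale0r scaler0.
have [Hc|/Hu' ->] := eqVneq (par r (+) par s) c; last first.
  by rewrite mulr0 !mul0r !scale0r scaler0.
rewrite (oscXX r p) (oscDD s q) !linearZ /= !scalerA; congr (_ *: _).
rewrite -Hb -Hc /sg.
by case: (par p); case: (par q); case: (par r); case: (par s);
  rewrite /= ?expr0 ?expr1; ring.
Qed.

(* The supertrace. *)
Definition str (u : 'M[C]_(m + 1)) : C := \sum_p sg (par p) * u p p.

Lemma str_linear : scalar str.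
Proof.
move=> c u v; rewrite /str mulr_sumr -big_split; apply: eq_bigr => p _ /=.
by rewrite !mxE mulrDr mulrCA.
Qed.
HB.instance Definition _ :=
  GRing.isLinear.Build C 'M[C]_(m + 1) C^o _ str str_linear.

Lemma str_delta p q : str (delta_mx p q) = (p == q)%:R * sg (par p).
Proof.
rewrite /str (bigD1 p) //= big1 ?addr0 => [|r /negbTE rp].
  by rewrite mxE eqxx mulrC.
by rewrite mxE rp mulr0.
Qed.

Lemma sl_str u : u \in sl -> str u = 0.
Proof.
have H : (sl <= lker (linfun (str : 'M[C]_(m + 1) -> C^o)))%VS.
  rewrite /sl !subv_add; apply/andP; split; [apply/andP; split|];
      [apply/andP; split| |]; apply/subv_sumP => i _.
  - rewrite -memvE memv_ker lfunE /= /h linearD /= !str_delta !eqxx parL parR.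
    by rewrite !mul1r /sg addrN.
  - apply/subv_sumP => j ji; rewrite -memvE memv_ker lfunE /= str_delta.
    by rewrite /ix eq_lshift (eq_sym i) (negbTE ji) mul0r.
  - rewrite -memvE memv_ker lfunE /= str_delta.
    by rewrite /ix /bar eq_lrshift mul0r.
  - rewrite -memvE memv_ker lfunE /= str_delta.
    by rewrite /ix /bar eq_rlshift mul0r.
by move/(subvP H); rewrite memv_ker lfunE /= => /eqP.
Qed.

Lemma str_bracket b c u u' : mx_parity b u -> mx_parity c u' ->
  str (sbracket b c u u') = 0.
Proof.
move=> Hu Hu'; rewrite /str.
under eq_bigr => p _ do rewrite !mxE mulrBr !mulr_sumr.
rewrite sumrB; apply/eqP; rewrite subr_eq0; apply/eqP.
rewrite [RHS]exchange_big /=; apply: eq_bigr => p _; apply: eq_bigr => q _.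
have [Hb|/Hu ->] := eqVneq (par p (+) par q) b; last first.
  by rewrite !mulr0 !mul0r !mulr0.
have [Hc|/Hu' ->] := eqVneq (par q (+) par p) c; last first.
  by rewrite !mul0r !mulr0.
rewrite -Hb -Hc /sg.
by case: (par p); case: (par q); rewrite /= ?expr0 ?expr1; ring.
Qed.

Lemma exp_act_osc u v : str u = 0 -> exp_act u v = osc u v.
Proof.
rewrite /str big_split_ord big_ord1 /= -/bar parR => Hs.
have Ebar : u bar bar = \sum_(i < m) u (ix i) (ix i).
  apply/esym/eqP; rewrite -subr_eq0; apply/eqP; rewrite -[RHS]Hs.
  rewrite /sg expr1 mulN1r; congr (_ + _); apply: eq_bigr => i _.
  by rewrite -/(ix i) parL expr0 mul1r.
have Eh i : act_h i v = oscX (ix i) (oscD (ix i) v) + xi (dxi v).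
  rewrite /act_h oscX_ix oscD_ix; case: ifP => // _.
  by rewrite d_N dx_C eqxx scale1r opprD.
have Ee i j : j != i -> act_e i j v = oscX (ix i) (oscD (ix j) v).
  move=> ji; rewrite /act_e oscX_ix oscD_ix.
  case: ifP => _; case: ifP => _ //; last by rewrite x_N.
  by rewrite d_N dx_C eq_sym (negbTE ji) scale0r addr0.
have Eb i : act_e_bar i v = oscX (ix i) (oscD bar v).
  by rewrite /act_e_bar oscX_ix oscD_bar; case: ifP.
have Ec i : act_bar_e i v = oscX bar (oscD (ix i) v).
  rewrite /act_bar_e oscX_bar oscD_ix; case: ifP => // _.
  by rewrite xi_N x_xi.
have -> : osc u v =
    \sum_(i < m) u (ix i) (ix i) *: oscX (ix i) (oscD (ix i) v)
    + \sum_(i < m) \sum_(j < m | j != i)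
        u (ix i) (ix j) *: oscX (ix i) (oscD (ix j) v)
    + \sum_(i < m) u (ix i) bar *: oscX (ix i) (oscD bar v)
    + (\sum_(i < m) u bar (ix i) *: oscX bar (oscD (ix i) v)
       + u bar bar *: oscX bar (oscD bar v)).
  rewrite /osc big_split_ord /= big_ord1; congr (_ + _).
    rewrite -!big_split /=; apply: eq_bigr => i _.
    by rewrite big_split_ord /= big_ord1 (bigD1 i).
  by rewrite big_split_ord /= big_ord1.
rewrite /exp_act Ebar scaler_suml oscX_bar oscD_bar.
have -> : \sum_(i < m) u (ix i) (ix i) *: act_h i v =
    \sum_(i < m) u (ix i) (ix i) *: oscX (ix i) (oscD (ix i) v)
    + \sum_(i < m) u (ix i) (ix i) *: xi (dxi v).
  by rewrite -big_split; apply: eq_bigr => i _; rewrite Eh scalerDr.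
have -> : \sum_(i < m) \sum_(j < m | j != i) u (ix i) (ix j) *: act_e i j v =
    \sum_(i < m) \sum_(j < m | j != i)
      u (ix i) (ix j) *: oscX (ix i) (oscD (ix j) v).
  by apply: eq_bigr => i _; apply: eq_bigr => j ji; rewrite Ee.
under [X in _ + _ + X + _ = _]eq_bigr => i _ do rewrite Eb oscD_bar.
under [X in _ + X = _]eq_bigr => i _ do rewrite Ec oscX_bar.
by rewrite -!addrA; congr (_ + _); rewrite addrC -!addrA.
Qed.

Lemma oscX_parity p b v : vec_parity b v -> vec_parity (par p (+) b) (oscX p v).
Proof.
case: (indexP p) => [i|]; rewrite ?parL ?parR ?oscX_ix ?oscX_bar /=.
  by case: ifP => _; [exact: d_parity | exact: x_parity].
exact: xi_parity.
Qed.
Lemma oscD_parity p b v : vec_parity b v -> vec_parity (par p (+) b) (oscD p v).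
Proof.
case: (indexP p) => [i|]; rewrite ?parL ?parR ?oscD_ix ?oscD_bar /=.
  case: ifP => _; last exact: d_parity.
  by move=> /(x_parity i) /(vec_parityZ (-1)); rewrite scaleN1r.
exact: dxi_parity.
Qed.

Lemma exp_act_linear_mx c u u' v : u \in sl -> u' \in sl ->
  exp_act (c *: u + u') v = c *: exp_act u v + exp_act u' v.
Proof.
move=> Hu Hu'; rewrite !exp_act_osc ?sl_str ?memvD ?memvZ //.
rewrite /osc scaler_sumr -big_split; apply: eq_bigr => p _ /=.
rewrite scaler_sumr -big_split; apply: eq_bigr => q _ /=.
by rewrite !mxE scalerDl scalerA.
Qed.

Lemma exp_act_linear u : u \in sl -> forall c v v',
  exp_act u (c *: v + v') = c *: exp_act u v + exp_act u v'.
Proof.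
move=> Hu c v v'; rewrite !exp_act_osc ?sl_str //.
rewrite /osc scaler_sumr -big_split; apply: eq_bigr => p _ /=.
rewrite scaler_sumr -big_split; apply: eq_bigr => q _ /=.
by rewrite oscD_linear oscX_linear scalerDr !scalerA mulrC.
Qed.

Lemma exp_act_parity b c u v : u \in sl -> mx_parity b u -> vec_parity c v ->
  vec_parity (b (+) c) (exp_act u v).
Proof.
move=> Hu Hb Hc; rewrite exp_act_osc ?sl_str //.
apply: (big_ind (vec_parity _)) => [||p _];
  [exact: vec_parity0 | exact: vec_parityD |].
apply: (big_ind (vec_parity _)) => [||q _];
  [exact: vec_parity0 | exact: vec_parityD |].
have [<-|/Hb ->] := eqVneq (par p (+) par q) b; last first.
  by rewrite scale0r; apply: vec_parity0.
by rewrite -addbA; apply/vec_parityZ/oscX_parity/oscD_parity.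
Qed.

Lemma exp_act_bracket b c u u' v : u \in sl -> u' \in sl ->
  mx_parity b u -> mx_parity c u' ->
  exp_act (sbracket b c u u') v
  = exp_act u (exp_act u' v) - (-1) ^+ (b && c) *: exp_act u' (exp_act u v).
Proof.
move=> Hu Hu' Hb Hc.
rewrite exp_act_osc; last exact: str_bracket.
by rewrite !exp_act_osc ?sl_str // osc_bracket.
Qed.

Definition expE : slmod C m :=
  SlMod exp_act_linear_mx exp_act_linear exp_act_parity exp_act_bracket.

End Exponential.

(* Main.v *)
From HB Require Import structures.
Require Import Defs.
From mathcomp Require Import all_boot all_order all_algebra.
From mathcomp Require Import reals complex mpoly.
From mathcomp Require boolp.
From mathcomp Require Import zify ring.

Set Implicit Arguments.
Unset Strict Implicit.
Unset Printing Implicit Defensive.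

Import GRing.Theory.
Local Open Scope ring_scope.

(** Write X_p and D_p for the creation and annihilation operators through which
    gl(m|1) acts, e_pq being sent to X_p D_q. On polynomials times e^g, with
    g = \sum_i a_i x_i^(k_i), the operators X_i and D_i (i an ordinary index)
    are, up to a sign, multiplication by x_i and d/dx_i + a_i k_i x_i^(k_i - 1),
    in an order which depends on whether i lies in S.

    If some d > 1 divides all the k_i, count degrees modulo d, giving x_i degree
    1 or -1 according to S and xi degree 1. The terms of g have degree 0, so
    every X_p has degree 1 and every D_p degree -1: sl(m|1) preserves the
    degree. The part of degree 0 (which contains 1) and the sum of the other
    parts (which contains xi) are complementary submodules
    ([graded_not_indecomposable]).

    Suppose conversely that the gcd is 1, and let P be the projection of a
    decomposition into two submodules. On the even part C[x] e^g it is an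
    idempotent which commutes with all the X_i D_j. For the ordinary total
    degree, X_i D_j is multiplication by a nonzero multiple of a monomial, plus
    terms of lower degree ([leading_creation_annihilation]). The argument then
    looks at leading terms.
    - The leading monomials of the X_i D_i are the x_i^(k_i), over whose
      subalgebra C[x] is finitely generated; hence P raises degrees by a bounded
      amount ([commuting_order_le]).
    - The monomials with which P commutes to leading order form a monoid from
      which one may also cancel, because C[x] is a domain. It contains the
      leading monomials of all the X_i D_j, and in the quotient of Z^m by these
      all the x_i are, up to sign, one element killed by every k_i. As the gcd
      is 1, the monoid consists of all monomials ([saturated_full]).
    - So the leading part of P is multiplication by the leading part of P(1).
      If that had positive degree, squaring P would double the degree; so the
      leading part is a constant c with c^2 = c, and P - c lowers degrees. An
      idempotent which lowers degrees is 0, so P is 0 or 1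
      ([idempotent_scalar]).

    One of the summands thus has no even part. It has no odd part either,
    because e_(i,bar) maps its odd part into its even part by X_i, which is
    injective ([submodule_even_trivial]). *)

(** * Leading terms of operators on polynomials *)

Section DegreeBounds.
Variables (n : nat) (C : fieldType).
Implicit Types (p q f : {mpoly C[n]}) (al be : 'X_{1..n}).

Lemma leq_msizeD d p q :
  (msize p <= d)%N -> (msize q <= d)%N -> (msize (p + q) <= d)%N.
Proof.
by move=> hp hq; apply: leq_trans (mmeasureD_le _ _ _) _; rewrite geq_max hp.
Qed.

Lemma leq_msizeZ d c p : (msize p <= d)%N -> (msize (c *: p) <= d)%N.
Proof. exact: leq_trans (msizeZ_le _ _). Qed.

Lemma leq_msizeB d p q :
  (msize p <= d)%N -> (msize q <= d)%N -> (msize (p - q) <= d)%N.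
Proof.
by move=> hp hq; apply: leq_msizeD => //; rewrite -scaleN1r leq_msizeZ.
Qed.

Lemma leq_msizeXM al f d :
  (msize ('X_[al] * f) <= mdeg al + d)%N = (msize f <= d)%N.
Proof.
have [->|f0] := eqVneq f 0; first by rewrite mulr0 msize0.
rewrite msizeM ?msizeX ?addSn ?leq_add2l //.
by rewrite -msize_poly_eq0 msizeX.
Qed.

Lemma leq_msizeM a b p q :
  (msize p <= a.+1)%N -> (msize q <= b)%N -> (msize (p * q) <= a + b)%N.
Proof.
move=> hp hq.
have [->|p0] := eqVneq p 0; first by rewrite mul0r msize0.
have [->|q0] := eqVneq q 0; first by rewrite mulr0 msize0.
rewrite msizeM //; move: (msize p) (msize q) hp hq => x y hp hq; lia.
Qed.

(** A bound on the image of polynomials of bounded degree may be checked on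
    monomials. *)
Lemma leq_msize_linear (L : {mpoly C[n]} -> {mpoly C[n]}) d b : linear L ->
    (forall al, (mdeg al < d)%N -> (msize (L 'X_[al]) <= b)%N) ->
  forall f, (msize f <= d)%N -> (msize (L f) <= b)%N.
Proof.
move=> linL hL f hf.
have L0 : L 0 = 0 by have := linL (-1) 0 0; rewrite scaler0 add0r scaleN1r addNr.
rewrite (mpolyE f) big_seq.
elim/big_rec: _ => [|al p hal hp]; first by rewrite L0 msize0.
rewrite linL leq_msizeD ?leq_msizeZ ?hL //.
exact: leq_trans (msize_mdeg_lt hal) hf.
Qed.

(** Recall that [msize] is the total degree plus 1: the error term has degree
    less than d + |al| when f has degree at most d. Phrasing it with d.+1 instead
    of the size of f keeps the predicate stable under composition, the zero
    polynomial needing no separate treatment. *)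
Definition leading (T : {mpoly C[n]} -> {mpoly C[n]}) (c : C) al :=
  forall d f, (msize f <= d.+1)%N ->
    (msize (T f - c *: ('X_[al] * f)) <= d + mdeg al)%N.

Lemma leading_size T c al d f : leading T c al ->
  (msize f <= d.+1)%N -> (msize (T f) <= d.+1 + mdeg al)%N.
Proof.
move=> hT hf; rewrite -[T f](subrK (c *: ('X_[al] * f))).
apply: leq_msizeD; first by apply: leq_trans (hT _ _ hf) _; lia.
by apply: leq_msizeZ; rewrite addnC leq_msizeXM.
Qed.

Lemma leading_comp T T' c c' al al' : leading T c al -> leading T' c' al' ->
  leading (T \o T') (c * c') (al + al')%MM.
Proof.
move=> hT hT' d f hf /=.
have -> : T (T' f) - (c * c') *: ('X_[al + al'] * f) =
    (T (T' f) - c *: ('X_[al] * T' f)) +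
    c *: ('X_[al] * (T' f - c' *: ('X_[al'] * f))).
  by rewrite mpolyXD -!mul_mpolyC mpolyCM; ring.
rewrite mdegD; apply: leq_msizeD.
  have := hT _ _ (leading_size hT' hf).
  by rewrite -addnA (addnC (mdeg al')).
by apply: leq_msizeZ; rewrite addnCA leq_msizeXM hT'.
Qed.

End DegreeBounds.

(** * Submonoids of the exponents that are stable under cancellation *)

Section SaturatedMonoid.
Variables (n : nat) (D : 'X_{1..n} -> Prop).
Hypotheses (D0 : D 0%MM)
  (Dadd : forall al be, D al -> D be -> D (al + be)%MM)
  (Dcancel : forall al be, D (al + be)%MM -> D be -> D al).

Lemma saturatedMn al c : D al -> D (al *+ c)%MM.
Proof.
move=> h; elim: c => [|c IH]; first by rewrite mulm0n.
by rewrite mulmS; apply: Dadd.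
Qed.

(** Bezout: u a = v b + gcd(a, b), and the term v b cancels. *)
Lemma saturated_gcd al a b :
  D (al *+ a)%MM -> D (al *+ b)%MM -> D (al *+ gcdn a b)%MM.
Proof.
case: (posnP a) => [-> _|a_gt0]; first by rewrite gcd0n.
move=> ha hb; case: (egcdnP b a_gt0) => u v e _.
apply: (@Dcancel _ (al *+ b *+ v)%MM); last exact: saturatedMn.
have -> : (al *+ gcdn a b + al *+ b *+ v)%MM = (al *+ a *+ u)%MM.
  by apply/mnmP => i; rewrite !(mulmnE, mnmDE); nia.
exact: saturatedMn.
Qed.

Variables (S : {set 'I_n}) (k : 'I_n -> nat).
Hypothesis (k_gt0 : forall i, (0 < k i)%N).

(** The exponents of the leading monomials of X_i and, next, of D_i. *)
Definition creation_mnm i : 'X_{1..n} :=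
  if i \in S then (U_(i) *+ (k i).-1)%MM else U_(i)%MM.
Definition annihilation_mnm i : 'X_{1..n} :=
  if i \in S then U_(i)%MM else (U_(i) *+ (k i).-1)%MM.

Lemma creation_annihilation_mnm i :
  (creation_mnm i + annihilation_mnm i)%MM = (U_(i) *+ k i)%MM.
Proof.
rewrite /creation_mnm /annihilation_mnm -[in RHS](prednK (k_gt0 i)).
by rewrite mulmS; case: ifP => _ //; rewrite addmC.
Qed.

Hypothesis Dmunu : forall i j, D (creation_mnm i + annihilation_mnm j)%MM.

(** In the group quotient by D, the creation exponents are all equal to some t
    and the annihilation exponents all equal to -t. One of the two exponents of
    index j is U_(j) and the other U_(j) *+ (k j).-1, so comparing them gives
    k_j t = 0. The proof spells this out without subtraction. *)
Lemma saturated_creation_exponent i j : D (creation_mnm i *+ k j)%MM.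
Proof.
have [jS|jS] := boolP (j \in S).
  apply: (@Dcancel _ (annihilation_mnm j *+ k j)%MM).
    have -> : (creation_mnm i *+ k j + annihilation_mnm j *+ k j)%MM =
              ((creation_mnm i + annihilation_mnm j) *+ k j)%MM.
      by apply/mnmP => l; rewrite !(mulmnE, mnmDE) mulnDl.
    exact: saturatedMn.
  by move: (Dmunu j j); rewrite creation_annihilation_mnm /annihilation_mnm jS.
have [K EK] : exists K, k j = K.+1 by exists (k j).-1; rewrite prednK.
apply: (@Dcancel _ ((creation_mnm j + annihilation_mnm i) *+ K)%MM); last first.
  exact: saturatedMn.
have -> : (creation_mnm i *+ k j + (creation_mnm j + annihilation_mnm i) *+ K)%MM =
  ((creation_mnm i + annihilation_mnm j) +
   (creation_mnm i + annihilation_mnm i) *+ K)%MM.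
  rewrite /(annihilation_mnm j) {2}/creation_mnm (negbTE jS) EK /=.
  by apply/mnmP => l; rewrite !(mulmnE, mnmDE); ring.
by apply: Dadd => //; apply: saturatedMn.
Qed.

Lemma saturated_full : (\big[gcdn/0]_(i < n) k i)%N = 1%N -> forall al, D al.
Proof.
move=> gcd1.
have Dcr i : D (creation_mnm i).
  have : D (creation_mnm i *+ (\big[gcdn/0]_(j < n) k j)%N)%MM.
    apply: (big_rec (fun d => D (creation_mnm i *+ d)%MM)) => [|j d _ IH].
      by rewrite mulm0n.
    by apply: saturated_gcd => //; apply: saturated_creation_exponent.
  by rewrite gcd1 mulm1n.
have Dan i : D (annihilation_mnm i).
  by apply: (@Dcancel _ (creation_mnm i)) => //; rewrite addmC.
have D1 i : D U_(i)%MM.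
  by have := Dcr i; have := Dan i; rewrite /creation_mnm /annihilation_mnm;
     case: ifP.
move=> al; rewrite (multinomUE_id al).
apply: big_rec => [//|i be _ IH].
by apply: Dadd => //; apply: saturatedMn.
Qed.

End SaturatedMonoid.

(** * Idempotents commuting with operators that have a leading monomial *)

Section Idempotent.
Variables (n : nat) (C : fieldType).
Variable P : {linear {mpoly C[n]} -> {mpoly C[n]}}.
Implicit Types (p q f : {mpoly C[n]}) (al be : 'X_{1..n}).

Definition order_le (N : nat) := forall d f,
  (msize f <= d.+1)%N -> (msize (P f) <= d.+1 + N)%N.

Definition commutes_to_leading (N : nat) al := forall d f, (msize f <= d.+1)%N ->
  (msize (P ('X_[al] * f) - 'X_[al] * P f)%R <= d + N + mdeg al)%N.

Section Commutation.
Variable N : nat.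
Hypothesis PN : order_le N.

Lemma commutes_to_leading0 : commutes_to_leading N 0%MM.
Proof. by move=> d f _; rewrite mpolyX0 !mul1r subrr msize0. Qed.

Lemma commutes_to_leadingD al be : commutes_to_leading N al ->
  commutes_to_leading N be -> commutes_to_leading N (al + be)%MM.
Proof.
move=> ha hb d f hf; rewrite mpolyXD mdegD -mulrA.
rewrite -[X in msize X](subrKA ('X_[al] * P ('X_[be] * f))).
apply: leq_msizeD.
  have hXf : (msize ('X_[be] * f) <= (d + mdeg be).+1)%N.
    by rewrite -addSn addnC leq_msizeXM.
  by apply: leq_trans (ha _ _ hXf) _; lia.
rewrite -mulrA -mulrBr addnCA leq_msizeXM.
exact: hb.
Qed.

(** The error term of al, multiplied by 'X_[be], is a difference of two error
    terms, and multiplication by a monomial shifts degrees exactly. *)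
Lemma commutes_to_leading_cancel al be : commutes_to_leading N (al + be)%MM ->
  commutes_to_leading N be -> commutes_to_leading N al.
Proof.
move=> hab hb d f hf.
rewrite -(leq_msizeXM be).
have -> : 'X_[be] * (P ('X_[al] * f) - 'X_[al] * P f) =
   (P ('X_[al + be] * f) - 'X_[al + be] * P f) -
   (P ('X_[be] * ('X_[al] * f)) - 'X_[be] * P ('X_[al] * f)).
  by rewrite mulrA -mpolyXD (addmC be) mpolyXD; ring.
apply: leq_msizeB.
  by apply: leq_trans (hab _ _ hf) _; rewrite mdegD; lia.
have hXf : (msize ('X_[al] * f) <= (d + mdeg al).+1)%N.
  by rewrite -addSn addnC leq_msizeXM.
by apply: leq_trans (hb _ _ hXf) _; lia.
Qed.

Lemma commutes_to_leading_symbol T c al : c != 0 -> leading T c al ->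
  (forall f, P (T f) = T (P f)) -> commutes_to_leading N al.
Proof.
move=> c0 hT PT d f hf.
rewrite -[msize _](@msizeZ _ _ c) //.
have -> : c *: (P ('X_[al] * f) - 'X_[al] * P f) =
  (T (P f) - c *: ('X_[al] * P f)) - P (T f - c *: ('X_[al] * f)).
  by rewrite (linearB P) [P (_ *: _)]linearZ /= PT -!mul_mpolyC; ring.
apply: leq_msizeB.
  by apply: hT; rewrite -addSn; apply: PN.
have := hT _ _ hf; case E : (d + mdeg al)%N => [|e] he.
  by move: he; rewrite leqn0 msize_poly_eq0 => /eqP ->; rewrite linear0 msize0.
by apply: leq_trans (PN he) _; lia.
Qed.

End Commutation.

(** By induction on the degree. A monomial divisible by some x_i^(k_i) is, up to
    a factor and lower terms, T_i of a monomial, and P commutes with T_i; only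
    finitely many monomials are divisible by none of them. *)
Lemma commuting_order_le (T : 'I_n -> {mpoly C[n]} -> {mpoly C[n]})
    (k : 'I_n -> nat) : (forall i, (0 < k i)%N) ->
  (forall i, exists2 c, c != 0 & leading (T i) c (U_(i) *+ k i)%MM) ->
  (forall i f, P (T i f) = T i (P f)) -> exists N, order_le N.
Proof.
move=> k_gt0 hT PT; pose M := (\sum_i k i).+1.
pose N := \max_(al : 'X_{1..n < M}) msize (P 'X_[al]).
exists N => d f; move: d.+1 f => {}d.
elim/ltn_ind: d => d IH; apply: leq_msize_linear => [|al had]; first exact: linearP.
(* M exceeds the degree of every monomial divisible by no x_i^(k_i). *)
have [/existsP [i ki]|/existsPn kn] := boolP [exists i, (k i <= al i)%N]; last first.
  have alM : (mdeg al < M)%N.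
    by rewrite ltnS mdegE; apply: leq_sum => i _; rewrite ltnW // ltnNge.
  apply: leq_trans (leq_addl d N).
  exact: (leq_bigmax (F := fun be : 'X_{1..n < M} => msize (P 'X_[be]))
            (BMultinom alM)).
have {hT} [c c0 hT] := hT i.
pose be := (al - U_(i) *+ k i)%MM.
have Eal : al = (U_(i) *+ k i + be)%MM.
  rewrite addmC submK //; apply/mnm_lepP => j; rewrite mulmnE mnm1E.
  by case: eqP => [<-|_]; rewrite ?mul1n ?mul0n.
have degal : mdeg al = (k i + mdeg be)%N.
  by rewrite Eal mdegD mdegMn mdeg1 mul1n.
rewrite -[msize _](@msizeZ _ _ c) //.
have -> : c *: P 'X_[al] =
    T i (P 'X_[be]) - P (T i 'X_[be] - c *: ('X_[U_(i) *+ k i] * 'X_[be])).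
  by rewrite (linearB P) [P (_ *: _)]linearZ /= PT -mpolyXD -Eal; ring.
have hbe : (msize 'X_[C, be] <= (mdeg be).+1)%N by rewrite msizeX.
have := k_gt0 i => ki0.
apply: leq_msizeB.
  have hP : (msize (P 'X_[be]) <= (mdeg be + N).+1)%N.
    by have := IH (mdeg be).+1 _ _ hbe; rewrite addSn; apply; lia.
  by have := leading_size (hT) hP; rewrite mdegMn mdeg1 mul1n; lia.
have h := hT _ _ hbe; apply: leq_trans (IH _ _ _ h) _;
  by rewrite mdegMn mdeg1 mul1n; lia.
Qed.

Hypothesis PP : forall f, P (P f) = P f.

(** If P raises degrees by at most N + 1, then it agrees with multiplication by
    p = P 1 up to terms of smaller degree. If p had degree exactly N + 1, then
    P p = p would have the degree 2 (N + 1) of p * p; hence the degree of p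
    is at most N, and P raises degrees by at most N. *)
Lemma idempotent_order_le0 N : order_le N ->
  (forall M, order_le M -> forall al, commutes_to_leading M al) -> order_le 0.
Proof.
move=> + Hcom; elim: N => [//|N IH] PN; apply: IH.
set p := P 1.
have hp : (msize p <= N.+2)%N by have := PN 0%N 1; rewrite msize1; apply.
have Pmul d f : (msize f <= d.+1)%N -> (msize (P f - f * p)%R <= d + N.+1)%N.
  apply: (@leq_msize_linear _ _ (fun f => P f - f * p)) => [c u v|al had].
    by rewrite linearP mulrDl scalerBr scalerAl opprD addrACA.
  have := Hcom _ PN al 0%N 1; rewrite msize1 mulr1 => /(_ isT) h.
  by apply: leq_trans h _; lia.
have hpp : (msize p <= N.+1)%N.
  rewrite leqNgt; apply/negP => hp'.
  have Ep : msize p = N.+2 by apply/eqP; rewrite eqn_leq hp.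
  have p0 : p != 0 by rewrite -msize_poly_eq0 Ep.
  have := Pmul _ _ hp; rewrite {1}/p PP -/p => h.
  have : (msize (p - (p - p * p))%R <= (N.+1 + N.+1))%N.
    by apply: leq_msizeB => //; rewrite Ep; lia.
  by rewrite subKr msizeM // Ep; lia.
move=> d f hf; rewrite -[P f](subrK (f * p)).
apply: leq_msizeD; first by apply: leq_trans (Pmul _ _ hf) _; lia.
by apply: leq_trans (leq_msizeM hf hpp) _; lia.
Qed.

End Idempotent.

Lemma lowering_idempotent_eq0 n (C : fieldType)
    (P : {mpoly C[n]} -> {mpoly C[n]}) :
  (forall d f, (msize f <= d.+1)%N -> (msize (P f) <= d)%N) ->
  (forall f, P (P f) = P f) -> forall f, P f = 0.
Proof.
move=> hP PP f; apply/eqP; rewrite -msize_poly_eq0 -leqn0.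
have [d] : exists d, (msize (P f) <= d)%N by exists (msize (P f)).
elim: d => [//|d IH] hf; apply: IH; rewrite -PP; exact: hP.
Qed.

Lemma idempotent_scalar n (C : fieldType)
    (P : {linear {mpoly C[n]} -> {mpoly C[n]}}) :
  (forall f, P (P f) = P f) -> (exists N, order_le P N) ->
  (forall M, order_le P M -> forall al, commutes_to_leading P M al) ->
  (forall f, P f = 0) \/ (forall f, P f = f).
Proof.
move=> PP [N PN] Hcom.
have P0 := idempotent_order_le0 PP PN Hcom.
have [c Ec] : exists c, P 1 = c%:MP.
  exists (P 1)@_0; apply: msize1_polyC.
  by have := P0 0%N 1; rewrite msize1; apply.
have low d f : (msize f <= d.+1)%N -> (msize (P f - c *: f)%R <= d)%N.
  apply: (@leq_msize_linear _ _ (fun f => P f - c *: f)) => [b u v|al had].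
    by rewrite linearP -!mul_mpolyC; ring.
  have := Hcom _ P0 al 0%N 1; rewrite msize1 mulr1 => /(_ isT) h.
  by move: h; rewrite Ec mulrC mul_mpolyC => h; apply: leq_trans h _; lia.
have cc : c * c = c.
  have E1 : P (c *: 1) = c *: 1 by rewrite -[c *: 1]mul_mpolyC mulr1 -Ec PP.
  move: E1; rewrite linearZ /= Ec => /(congr1 (mcoeff 0)).
  by rewrite !mcoeffZ mcoeffC eqxx mcoeff1 eqxx !mulr1.
have /eqP : c * (c - 1) = 0 by rewrite mulrBr cc mulr1 subrr.
rewrite mulf_eq0 subr_eq0 => /orP [/eqP c0|/eqP c1]; [left|right] => f.
  apply: lowering_idempotent_eq0 f => // d f hf.
  by have := low _ _ hf; rewrite c0 scale0r subr0.
apply/esym/eqP; rewrite -subr_eq0; apply/eqP.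
apply: (@lowering_idempotent_eq0 _ _ (fun f => f - P f)) f => [d f hf|f].
  by rewrite -opprB -scaleN1r leq_msizeZ // -{2}[f]scale1r -c1 low.
by rewrite linearB /= PP subrr subr0.
Qed.

(** * The commutant of the oscillator operators *)

Section OscillatorSymbols.
Variables (C : fieldType) (n : nat) (a : 'I_n -> C) (k : 'I_n -> nat).
Variable S : {set 'I_n}.
Hypotheses (k_gt0 : forall i, (0 < k i)%N) (ak : forall i, a i *+ k i != 0).
Let g : {mpoly C[n]} := \sum_(i < n) a i *: 'X_i ^+ k i.

Definition twisted_deriv (g : {mpoly C[n]}) i (f : {mpoly C[n]}) :=
  f^`M(i) + f * g^`M(i).

(** The actions of X_i and, next, of D_i on f e^g. *)
Definition creation g i f :=
  if i \in S then twisted_deriv g i f else 'X_i * f.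
Definition annihilation g i f :=
  if i \in S then - ('X_i * f) else twisted_deriv g i f.

Lemma mderiv_potential i :
  g^`M(i) = (a i *+ k i) *: 'X_[U_(i) *+ (k i).-1].
Proof.
rewrite /g linear_sum (bigD1 i) //= big1 ?addr0 => [|j ji].
  rewrite linearZ /= mpolyXn mderivX mulmnE mnm1E eqxx mul1n scalerA mulr_natr.
  congr (_ *: 'X_[_]); apply/mnmP => l; by rewrite mnmBE !mulmnE -subn1 mulnBr muln1.
rewrite linearZ /= mpolyXn mderivX mulmnE mnm1E (negbTE ji) mul0n.
by rewrite scale0r scaler0.
Qed.

(** The derivative lowers the degree, while multiplication by the derivative of
    the potential does not. *)
Lemma leading_deriv i :
  leading (twisted_deriv g i) (a i *+ k i) (U_(i) *+ (k i).-1)%MM.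
Proof.
move=> d f hf; rewrite /twisted_deriv mderiv_potential -scalerAr mulrC addrK.
apply: leq_trans (leq_addr _ _).
rewrite msizeE; apply/bigmax_leqP_seq => al hal _.
rewrite -ltnS; apply: leq_trans hf; apply: leq_trans (msize_mdeg_lt (m := al + U_(i)) _).
  by rewrite mdegD mdeg1 addn1.
by move: hal; rewrite !mcoeff_msupp mcoeff_deriv; apply: contraNneq => ->; rewrite mul0rn.
Qed.

Lemma leading_X i : leading (fun f : {mpoly C[n]} => 'X_i * f) 1 U_(i)%MM.
Proof. by move=> d f _; rewrite scale1r subrr msize0. Qed.

Lemma leading_creation i :
  exists2 c, c != 0 & leading (creation g i) c (creation_mnm S k i).
Proof.
rewrite /creation /creation_mnm; case: ifP => _.
  exists (a i *+ k i) => //; exact: leading_deriv.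
exists 1; [exact: oner_neq0 | exact: leading_X].
Qed.

Lemma leading_annihilation i :
  exists2 c, c != 0 & leading (annihilation g i) c (annihilation_mnm S k i).
Proof.
rewrite /annihilation /annihilation_mnm; case: ifP => _.
  exists (-1); first by rewrite oppr_eq0 oner_neq0.
  by move=> d f _; rewrite scaleN1r subrr msize0.
exists (a i *+ k i) => //; exact: leading_deriv.
Qed.

Lemma leading_creation_annihilation i j :
  exists2 c, c != 0 & leading (creation g i \o annihilation g j) c
    (creation_mnm S k i + annihilation_mnm S k j)%MM.
Proof.
have [c c0 hc] := leading_creation i; have [c' c'0 hc'] := leading_annihilation j.
by exists (c * c'); [rewrite mulf_neq0 | apply: leading_comp].
Qed.

(** An operator with a nonzero leading coefficient does not kill the leading
    term of f. *)
Lemma creation_injective i f : creation g i f = 0 -> f = 0.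
Proof.
have [c c0 hc] := leading_creation i => f0; apply/eqP.
rewrite -msize_poly_eq0; case Ed : (msize f) => [//|d].
have := hc d f; rewrite f0 sub0r -scaleNr msizeZ ?oppr_eq0 // Ed => /(_ (leqnn _)).
by rewrite addnC leq_msizeXM Ed ltnn.
Qed.

Theorem commutant_scalar (P : {linear {mpoly C[n]} -> {mpoly C[n]}}) :
  (\big[gcdn/0]_(i < n) k i)%N = 1%N ->
  (forall f, P (P f) = P f) ->
  (forall i j f, P (creation g i (annihilation g j f)) =
                 creation g i (annihilation g j (P f))) ->
  (forall f, P f = 0) \/ (forall f, P f = f).
Proof.
move=> gcd1 PP Pcom; apply: idempotent_scalar => //.
  apply: (@commuting_order_le _ _ _
            (fun i => creation g i \o annihilation g i) k) => // i; last first.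
    by move=> f; apply: Pcom.
  have [c c0 hc] := leading_creation_annihilation i i.
  by exists c => //; move: hc; rewrite creation_annihilation_mnm.
move=> M PM; apply: (@saturated_full _ _ _ _ _ S k) => //.
- exact: commutes_to_leading0.
- exact: commutes_to_leadingD.
- exact: commutes_to_leading_cancel.
move=> i j; have [c c0 hc] := leading_creation_annihilation i j.
apply: (commutes_to_leading_symbol PM c0 hc) => f; exact: Pcom.
Qed.

End OscillatorSymbols.

(** * From submodules to idempotents *)

Section SubmoduleActions.
Variables (C : fieldType) (m : nat) (g : {mpoly C[m]}) (S : {set 'I_m}).

Lemma delta_mx_off (p q r s : 'I_(m + 1)) :
  (p != r) || (q != s) -> (delta_mx r s : 'M[C]_(m + 1)) p q = 0.
Proof. by rewrite mxE -negb_and => /negbTE ->. Qed.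

Lemma osc_delta p q v :
  osc g S (delta_mx p q) v = oscX g S p (oscD g S q v).
Proof.
rewrite /osc (bigD1 p) //= (bigD1 q) //= [X in _ + X + _]big1 => [|r rq].
  rewrite [X in _ + X]big1 => [|r rp]; first by rewrite mxE !eqxx scale1r !addr0.
  by rewrite big1 // => s _; rewrite delta_mx_off ?rp // scale0r.
by rewrite delta_mx_off ?rq ?orbT // scale0r.
Qed.

Lemma oscD_mx u u' v : osc g S (u + u') v = osc g S u v + osc g S u' v.
Proof.
rewrite /osc -big_split; apply: eq_bigr => p _ /=; rewrite -big_split.
by apply: eq_bigr => q _ /=; rewrite mxE scalerDl.
Qed.

Lemma h_in_sl (i : 'I_m) : h C i \in sl.
Proof.
rewrite /sl; do 3![apply: (subvP (addvSl _ _))].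
by apply: (subvP (sumv_sup i _ (subvv _))) => //; rewrite memv_line.
Qed.

Lemma e_in_sl (i j : 'I_m) : j != i -> delta_mx (ix i) (ix j) \in @sl C m.
Proof.
move=> ji; rewrite /sl; do 2![apply: (subvP (addvSl _ _))].
apply: (subvP (addvSr _ _)); apply: (subvP (sumv_sup i _ (subvv _))) => //.
by apply: (subvP (sumv_sup j _ (subvv _))) => //; rewrite memv_line.
Qed.

Lemma e_bar_in_sl (i : 'I_m) : delta_mx (ix i) bar \in @sl C m.
Proof.
rewrite /sl; apply: (subvP (addvSl _ _)); apply: (subvP (addvSr _ _)).
by apply: (subvP (sumv_sup i _ (subvv _))) => //; rewrite memv_line.
Qed.

(** For i = j the element is h_i, whose extra summand xi dxi vanishes on the even
    part. *)
Lemma act_even_part i j : exists2 u, u \in @sl C m & forall f,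
  exp_act g S u (f, 0) = (creation S g i (annihilation S g j f), 0).
Proof.
have E f : oscX g S (ix i) (oscD g S (ix j) (f, 0)) =
    (creation S g i (annihilation S g j f), 0).
  rewrite oscX_ix oscD_ix /creation /annihilation /twisted_deriv.
  by case: ifP => _; case: ifP => _; apply: pairP_;
     rewrite /= ?(mulr0, mderiv0, mul0r, addr0, oppr0).
have [ji|ji] := eqVneq j i; last first.
  exists (delta_mx (ix i) (ix j)); first exact: e_in_sl.
  by move=> f; rewrite exp_act_osc ?sl_str ?e_in_sl // osc_delta E.
exists (h C i); first exact: h_in_sl.
move=> f; rewrite exp_act_osc ?sl_str ?h_in_sl // oscD_mx !osc_delta -{2}ji E.
rewrite oscX_bar oscD_bar; apply: pairP_; rewrite /= ?addr0 //.
Qed.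

Lemma act_odd_part i f :
  exp_act g S (delta_mx (ix i) bar) (0, f) = (creation S g i f, 0).
Proof.
rewrite exp_act_osc ?sl_str ?e_bar_in_sl // osc_delta oscX_ix oscD_bar.
by rewrite /creation; case: ifP => _; apply: pairP_;
  rewrite /= ?(mulr0, mderiv0, mul0r, addr0).
Qed.

End SubmoduleActions.

Section SubmoduleProjection.
Variables (C : fieldType) (m : nat) (M : slmod C m).
Variables W1 W2 : carrier M -> Prop.
Hypotheses (sub1 : is_submodule W1) (sub2 : is_submodule W2)
  (W12 : internal_direct_sum W1 W2).

Lemma submodule_projection : exists P : carrier M -> carrier M,
  [/\ linear P, (forall v, (W1 v -> P v = v) /\ (W2 v -> P v = 0)),
      (forall v, v.2 = 0 -> (P v).2 = 0), (forall v, P (P v) = P v)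
    & forall u v, u \in sl -> P (act u v) = act u (P v)].
Proof.
case: sub1 sub2 W12 => [z1 lin1 hom1 act1] [z2 lin2 hom2 act2] [ex cap].
have [P PW] : exists P : carrier M -> carrier M,
    forall v, W1 (P v) /\ W2 (v - P v).
  have [P hP] := boolp.choice ex; exists P => v.
  by have [w2 [h1 h2 E]] := hP v; split=> //; rewrite {1}E addrAC subrr add0r.
have uniqP v w : W1 w -> W2 (v - w) -> P v = w.
  move=> h1 h2; have [p1 p2] := PW v; apply/eqP; rewrite -subr_eq0; apply/eqP.
  apply: cap; first by rewrite addrC -scaleN1r; apply: lin1.
  have -> : P v - w = (-1) *: (v - P v) + (v - w).
    by rewrite scaleN1r opprB addrA subrK.
  exact: lin2.
have P1 v : W1 v -> P v = v by move=> h; apply: uniqP => //; rewrite subrr.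
have P2 v : W2 v -> P v = 0 by move=> h; apply: uniqP => //; rewrite subr0.
exists P; split.
- move=> c v w; have [v1 v2] := PW v; have [w1 w2] := PW w.
  apply: uniqP; first exact: lin1.
  by rewrite opprD addrACA -scalerBr; apply: lin2.
- by move=> v; split; [apply: P1 | apply: P2].
- move=> v v0; have [v1 v2] := PW v.
  have [h1 _] := hom1 _ v1; have [h2 _] := hom2 _ v2.
  have -> : P v = ((P v).1, 0) :> carrier M; last by [].
  apply: uniqP => //.
  have -> // : v - ((P v).1, 0) = ((v - P v).1, 0) :> carrier M.
  by apply: injective_projections; rewrite //= v0 subr0.
- by move=> v; apply: P1; case: (PW v).
- move=> u v hu; have [v1 v2] := PW v; apply: uniqP; first exact: act1.
  have -> : act u v - act u (P v) = act u (v - P v).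
    have := act_linear hu (-1) (P v) v; rewrite !scaleN1r addrC => ->.
    by rewrite addrC.
  exact: act2.
Qed.

End SubmoduleProjection.

Section Indecomposable.
Variables (C : fieldType) (m : nat) (a : 'I_m -> C) (k : 'I_m -> nat).
Variable S : {set 'I_m}.
Hypotheses (m_gt0 : (0 < m)%N) (k_gt0 : forall i, (0 < k i)%N)
  (ak : forall i, a i *+ k i != 0).
Let g : {mpoly C[m]} := \sum_(i < m) a i *: 'X_i ^+ k i.

(** The element e_(i,bar) sends the odd part of W to its even part through the
    injective operator X_i. *)
Lemma submodule_even_trivial (W : carrier (expE g S) -> Prop) :
  is_submodule W -> (forall f, W (f, 0) -> f = 0) -> forall v, W v -> v = 0.
Proof.
move=> [_ _ homW actW] W0 v /homW [h1 h2].
apply: pairP_; first exact: W0.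
suff : creation S g (Ordinal m_gt0) v.2 = 0 by apply: creation_injective.
apply: W0; rewrite -act_odd_part.
by apply: (actW (delta_mx (ix (Ordinal m_gt0)) bar)) h2; apply: e_bar_in_sl.
Qed.

Lemma indecomposable_of_gcd1 :
  (\big[gcdn/0]_(i < m) k i)%N = 1%N -> indecomposable (expE g S).
Proof.
move=> gcd1; split.
  by exists (1, 0) => /(congr1 fst) /eqP; rewrite oner_eq0.
move=> W1 W2 sub1 sub2 W12.
have [P [linP P12 Pev PP Pact]] := submodule_projection sub1 sub2 W12.
pose Q (f : {mpoly C[m]}) : {mpoly C[m]} := (P (f, 0)).1.
have PQ f : P (f, 0) = (Q f, 0).
  by apply: pairP_ => //; apply: Pev.
have linQ : linear Q.
  move=> c u v; rewrite {1}/Q.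
  have -> : (c *: u + v, 0) = c *: (u, 0) + (v, 0) :> expV C m.
    by apply: pairP_; rewrite /= ?scaler0 ?addr0.
  by rewrite linP.
pose lQ : {linear {mpoly C[m]} -> {mpoly C[m]}} :=
  HB.pack Q (GRing.isLinear.Build C _ _ _ Q linQ).
have [Q0|Q1] : (forall f, Q f = 0) \/ (forall f, Q f = f).
  apply: (commutant_scalar (S := S) k_gt0 ak (P := lQ) gcd1) => [f|i j f] /=.
    by rewrite {1}/Q -PQ PP.
  have [u usl hu] := act_even_part g S i j.
  have := Pact u (f, 0) usl; rewrite /= PQ !hu PQ.
  by move/(congr1 fst).
- left; apply: submodule_even_trivial => // f /(proj1 (P12 _)).
  by rewrite PQ Q0 => /(congr1 fst).
- right; apply: submodule_even_trivial => // f /(proj2 (P12 _)).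
  by rewrite PQ Q1 => /(congr1 fst).
Qed.

End Indecomposable.

(** * The decomposition when the exponents have a common divisor *)

Section Grading.
Variables (C : fieldType) (m : nat) (a : 'I_m -> C) (k : 'I_m -> nat).
Variables (S : {set 'I_m}) (d : nat).
Hypotheses (d_gt1 : (1 < d)%N)
  (k_gt0 : forall i, (0 < k i)%N) (dk : forall i, (d %| k i)%N).
Let g : {mpoly C[m]} := \sum_(i < m) a i *: 'X_i ^+ k i.

(** With this sign every creation operator has degree 1, whether or not its index
    lies in S. *)
Definition sign_index (i : 'I_m) : 'Z_d := if i \in S then -1 else 1.
Definition signed_degree (al : 'X_{1..m}) : 'Z_d :=
  \sum_(i < m) sign_index i *+ al i.

Lemma signed_degreeD al be :
  signed_degree (al + be)%MM = signed_degree al + signed_degree be.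
Proof.
by rewrite -big_split; apply: eq_bigr => i _; rewrite mnmDE mulrnDr.
Qed.

Lemma signed_degree0 : signed_degree 0%MM = 0.
Proof. by apply: big1 => i _; rewrite mnm0E. Qed.

Lemma signed_degree1 i : signed_degree U_(i)%MM = sign_index i.
Proof.
rewrite /signed_degree (bigD1 i) //= mnm1E eqxx big1 ?addr0 // => j ji.
by rewrite mnm1E eq_sym (negbTE ji).
Qed.

Lemma signed_degreeMn al c : signed_degree (al *+ c)%MM = signed_degree al *+ c.
Proof.
by rewrite -sumrMnl; apply: eq_bigr => i _; rewrite mulmnE mulrnA.
Qed.

Lemma signed_degree_exponent i : signed_degree (U_(i) *+ k i)%MM = 0.
Proof.
rewrite signed_degreeMn signed_degree1 -mulr_natr.
have -> : (k i)%:R = 0 :> 'Z_d; last exact: mulr0.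
by apply/val_inj; rewrite /= val_Zp_nat //; apply/eqP; exact: dk.
Qed.

Definition degrees_in (A : pred 'Z_d) (f : {mpoly C[m]}) :=
  forall al, f@_al != 0 -> A (signed_degree al).

Lemma degrees_in0 A : degrees_in A 0.
Proof. by move=> al; rewrite mcoeff0 eqxx. Qed.

Lemma degrees_in_linear A c f f' :
  degrees_in A f -> degrees_in A f' -> degrees_in A (c *: f + f').
Proof.
move=> h h' al; rewrite mcoeffD mcoeffZ.
have [f0|/h //] := eqVneq f@_al 0; rewrite f0 mulr0 add0r; exact: h'.
Qed.

Lemma degrees_inZ A c f : degrees_in A f -> degrees_in A (c *: f).
Proof.
by move=> h; rewrite -[c *: f]addr0; apply: degrees_in_linear => //; apply: degrees_in0.
Qed.

Lemma degrees_inD A f f' :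
  degrees_in A f -> degrees_in A f' -> degrees_in A (f + f').
Proof. by move=> h h'; rewrite -[f]scale1r; apply: degrees_in_linear. Qed.

Definition shift (A : pred 'Z_d) (z : 'Z_d) : pred 'Z_d := fun y => A (y + z).

Lemma degrees_in_ext A B f : A =1 B -> degrees_in A f -> degrees_in B f.
Proof. by move=> AB h al /h; rewrite AB. Qed.

Lemma degrees_inM A al f :
  degrees_in (shift A (signed_degree al)) f -> degrees_in A ('X_[al] * f).
Proof.
move=> h; rewrite [f]mpolyE mulr_sumr big_seq.
apply: big_rec => [|be p hbe IH]; first exact: degrees_in0.
apply: degrees_inD => //; rewrite -scalerAr -mpolyXD; apply: degrees_inZ => ga.
rewrite mcoeffX; have [<- _|_] := eqVneq (al + be)%MM ga; last by rewrite eqxx.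
by rewrite signed_degreeD addrC; apply: h; rewrite -mcoeff_msupp.
Qed.

Lemma degrees_in_X A i f :
  degrees_in (shift A (sign_index i)) f -> degrees_in A ('X_i * f).
Proof. by move=> h; apply: degrees_inM; rewrite signed_degree1. Qed.

(** Both terms lower the degree of x_i: in the second, the exponent (k i).-1 is
    congruent to -1 modulo d. *)
Lemma degrees_in_deriv A i f :
  degrees_in (shift A (- sign_index i)) f -> degrees_in A (twisted_deriv g i f).
Proof.
move=> h; apply: degrees_inD => [al|].
  rewrite mcoeff_deriv => fal.
  have /h : f@_(al + U_(i))%MM != 0.
    by apply: contraNneq fal => f0; rewrite f0 mul0rn.
  by rewrite /shift signed_degreeD signed_degree1 addrK.
rewrite mderiv_potential -scalerAr mulrC; apply: degrees_inZ; apply: degrees_inM.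
suff -> : signed_degree (U_(i) *+ (k i).-1)%MM = - sign_index i by [].
apply/eqP; rewrite -addr_eq0 -signed_degree1 -signed_degreeD -mulmSr prednK //.
by rewrite signed_degree_exponent.
Qed.

Lemma degrees_in_creation A i f :
  degrees_in (shift A 1) f -> degrees_in A (creation S g i f).
Proof.
rewrite /creation; case: ifP => iS h.
  by apply: degrees_in_deriv; rewrite /sign_index iS opprK.
by apply: degrees_in_X; rewrite /sign_index iS.
Qed.

Lemma degrees_in_annihilation A i f :
  degrees_in (shift A (-1)) f -> degrees_in A (annihilation S g i f).
Proof.
rewrite /annihilation; case: ifP => iS h.
  rewrite -scaleN1r; apply/degrees_inZ/degrees_in_X.
  by rewrite /sign_index iS.
by apply: degrees_in_deriv; rewrite /sign_index iS.
Qed.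

(** The shift accounts for xi, which has degree 1. *)
Definition graded_part A (v : expV C m) :=
  degrees_in A v.1 /\ degrees_in (shift A 1) v.2.

Lemma graded_part0 A : graded_part A 0.
Proof. by split; apply: degrees_in0. Qed.

Lemma graded_part_linear A c v w :
  graded_part A v -> graded_part A w -> graded_part A (c *: v + w).
Proof. by move=> [? ?] [? ?]; split; apply: degrees_in_linear. Qed.

Lemma graded_part_oscX A p v :
  graded_part (shift A 1) v -> graded_part A (oscX g S p v).
Proof.
move=> [h1 h2]; case: (indexP p) => [i|]; last first.
  by rewrite oscX_bar; split=> //; apply: degrees_in0.
suff -> : oscX g S (ix i) v = (creation S g i v.1, creation S g i v.2).
  by split; apply: degrees_in_creation.
by rewrite oscX_ix /creation; case: ifP.
Qed.

Lemma graded_part_oscD A p v :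
  graded_part (shift A (-1)) v -> graded_part A (oscD g S p v).
Proof.
move=> [h1 h2]; case: (indexP p) => [i|]; last first.
  rewrite oscD_bar; split; last exact: degrees_in0.
  by apply: degrees_in_ext h2 => y; rewrite /shift addrK.
suff -> : oscD g S (ix i) v = (annihilation S g i v.1, annihilation S g i v.2).
  split; apply: degrees_in_annihilation => //.
  by apply: degrees_in_ext h2 => y; rewrite /shift addrAC.
by rewrite oscD_ix /annihilation; case: ifP.
Qed.

Lemma graded_part_submodule A : @is_submodule _ _ (expE g S) (graded_part A).
Proof.
split.
- exact: graded_part0.
- exact: graded_part_linear.
- by move=> v [h1 h2]; split; split=> //; apply: degrees_in0.
move=> u v usl [h1 h2]; rewrite /= exp_act_osc ?sl_str // /osc.
apply: big_rec => [|p w _ hw]; first exact: graded_part0.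
rewrite -[X in X + w]scale1r; apply: graded_part_linear => //.
apply: big_rec => [|q {}w _ {}hw]; first exact: graded_part0.
apply: graded_part_linear => //; apply/graded_part_oscX/graded_part_oscD.
by split; [move: h1|move: h2]; apply: degrees_in_ext => y; rewrite /shift ?addrNK.
Qed.

Lemma degrees_in_split (A B : pred 'Z_d) f : (forall y, A y || B y) ->
  exists f1 f2, [/\ degrees_in A f1, degrees_in B f2 & f = f1 + f2].
Proof.
move=> AB; rewrite [f]mpolyE.
apply: (big_rec (fun p => exists f1 f2,
  [/\ degrees_in A f1, degrees_in B f2 & p = f1 + f2])) => [|al p _ [f1 [f2 [h1 h2 ->]]]].
  by exists 0, 0; split; rewrite ?addr0 //; apply: degrees_in0.
have hX (D : pred 'Z_d) : D (signed_degree al) -> degrees_in D (f@_al *: 'X_[al]).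
  move=> hD; apply: degrees_inZ => be; rewrite mcoeffX.
  by have [<-|_] := eqVneq al be; rewrite ?eqxx.
case/orP: (AB (signed_degree al)) => /hX hal.
  by exists (f@_al *: 'X_[al] + f1), f2; split; rewrite ?addrA //; apply: degrees_inD.
by exists f1, (f@_al *: 'X_[al] + f2); split; rewrite 1?addrCA //; apply: degrees_inD.
Qed.

Lemma degrees_in_disjoint (A B : pred 'Z_d) f : (forall y, A y -> ~~ B y) ->
  degrees_in A f -> degrees_in B f -> f = 0.
Proof.
move=> AB hA hB; apply/mpolyP => al; rewrite mcoeff0; apply/eqP.
by apply: contraT => fal; have := AB _ (hA _ fal); rewrite hB.
Qed.

Lemma graded_not_indecomposable : ~ indecomposable (expE g S).
Proof.
have dec : @internal_direct_sum _ _ (expE g S)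
    (graded_part (pred1 0)) (graded_part (predC1 0)).
  split=> [v|v [h1 h2] [h1' h2']]; last first.
    by apply: pairP_; [apply: degrees_in_disjoint h1 h1'
                     | apply: degrees_in_disjoint h2 h2'] => y; rewrite /shift /= negbK.
  have [f1 [f2 [h1 h2 E]]] := @degrees_in_split (pred1 0) (predC1 0) v.1
    (fun y => orbN _).
  have [f1' [f2' [h1' h2' E']]] :=
    @degrees_in_split (shift (pred1 0) 1) (shift (predC1 0) 1) v.2 (fun y => orbN _).
  by exists (f1, f1'), (f2, f2'); split => //; apply: pairP_.
move=> [_ indec].
have [h|h] :=
  indec _ _ (graded_part_submodule _) (graded_part_submodule _) dec.
  have : (1, 0) = 0 :> expV C m.
    apply: h; split; last exact: degrees_in0.
    move=> al; rewrite mcoeff1; have [-> _|_] := eqVneq al 0%MM; last by rewrite eqxx.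
    by rewrite signed_degree0 /= eqxx.
  by move/(congr1 fst)/eqP; rewrite oner_eq0.
have : (0, 1) = 0 :> expV C m.
  apply: h; split; first exact: degrees_in0.
  move=> al; rewrite mcoeff1; have [-> _|_] := eqVneq al 0%MM; last by rewrite eqxx.
  by rewrite signed_degree0 /shift add0r; apply: oner_neq0.
by move/(congr1 snd)/eqP; rewrite oner_eq0.
Qed.

End Grading.

Unset Implicit Arguments.

Theorem theorem5p11 (R : realType) (m : nat) (hm : (2 <= m)%N)
    (a : 'I_m -> R[i]) (ha : forall i, a i != 0)
    (k : 'I_m -> nat) (hk : forall i, (1 <= k i)%N)
    (S : {set 'I_m}) :
  indecomposable (expE (\sum_(i < m) a i *: 'X_i ^+ k i) S)
  <-> (\big[gcdn/0]_(i < m) k i)%N = 1%N.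
Proof.
have m_gt0 : (0 < m)%N by apply: ltn_trans hm.
set d := (\big[gcdn/0]_(i < m) k i)%N.
have dk i : (d %| k i)%N by rewrite /d (bigD1 i) //= dvdn_gcdl.
split=> [indec|]; last first.
  apply: indecomposable_of_gcd1 => // i.
  by rewrite Num.Theory.mulrn_eq0 negb_or -lt0n hk ha.
have := dvdn_gt0 (hk (Ordinal m_gt0)) (dk _); rewrite leq_eqVlt => /orP [/eqP //|d_gt1].
by case: (graded_not_indecomposable d_gt1 hk dk indec).
Qed.
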